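(* A complex tensor $T\in\mathbb{C}^{n\times n\times n}$ of order 3 belongs to $\mathrm{OT}_n(\mathbb{C})$ if and only if each of the three families of slices of $T$ (the $x$-slices, the $y$-slices and the $z$-slices), denoting the family by $M_1,\dots,M_n$, satisfies: (i) for each $k$, $M_k^TM_k$ is diagonalizable and $\operatorname{rank}M_k=\operatorname{rank}M_k^TM_k$; and (ii) the matrices $M_kM_l^T$ and $M_k^TM_l$ are symmetric for all $k,l\in\{1,\dots,n\}$.
   Context: Associate to $T$ the trilinear form $t(x,y,z)=\sum_{i,j,k}T_{ijk}x_iy_jz_k$. $\mathrm{OT}_n(\mathbb{C})$ is the set of tensors whose trilinear form can be written $t(x,y,z)=g(Ax,By,Cz)$ with $A,B,C\in M_n(\mathbb{C})$ complex orthogonal ($A^TA=\mathrm{Id}$ etc.) and $g(x,y,z)=\sum_{i=1}^n\alpha_ix_iy_iz_i$, $\alpha_i\in\mathbb{C}$. Slices: $X_k=(T_{kjl})_{j,l}$ (matrix of $\partial t/\partial x_k$ in $(y,z)$), $Y_k=(T_{ikl})_{i,l}$ (matrix of $\partial t/\partial y_k$ in $(x,z)$), $Z_k=(T_{ijk})_{i,j}$ (matrix of $\partial t/\partial z_k$ in $(x,y)$). *)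

(* Defs.v *)
From HB Require Import structures.
From mathcomp Require Import all_boot all_order all_algebra.
Set Implicit Arguments. Unset Strict Implicit. Unset Printing Implicit Defensive.
Import Order.TTheory GRing.Theory Num.Theory.
Local Open Scope ring_scope.

Definition tensor3 (C : Type) (n : nat) := 'I_n -> 'I_n -> 'I_n -> C.

Definition tform (C : numClosedFieldType) n (T : tensor3 C n)
  (x y z : 'cV[C]_n) : C :=
  \sum_(i < n) \sum_(j < n) \sum_(k < n) T i j k * x i 0 * y j 0 * z k 0.

Definition gform (C : numClosedFieldType) n (alpha : 'I_n -> C)
  (x y z : 'cV[C]_n) : C :=
  \sum_(i < n) alpha i * x i 0 * y i 0 * z i 0.

Definition orthogonal_mx (C : numClosedFieldType) n (A : 'M[C]_n) : Prop :=
  A^T *m A = 1%:M.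

Definition in_OT (C : numClosedFieldType) n (T : tensor3 C n) : Prop :=
  exists (A B D : 'M[C]_n) (alpha : 'I_n -> C),
    [/\ orthogonal_mx A, orthogonal_mx B, orthogonal_mx D &
      forall x y z : 'cV[C]_n,
        tform T x y z = gform alpha (A *m x) (B *m y) (D *m z)].

Definition xslice (C : numClosedFieldType) n (T : tensor3 C n) (k : 'I_n)
  : 'M[C]_n := \matrix_(j, l) T k j l.
Definition yslice (C : numClosedFieldType) n (T : tensor3 C n) (k : 'I_n)
  : 'M[C]_n := \matrix_(i, l) T i k l.
Definition zslice (C : numClosedFieldType) n (T : tensor3 C n) (k : 'I_n)
  : 'M[C]_n := \matrix_(i, j) T i j k.

Definition symmetric_mx (C : numClosedFieldType) n (M : 'M[C]_n) : Prop :=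
  M^T = M.

Definition slice_conditions (C : numClosedFieldType) n (M : 'I_n -> 'M[C]_n)
  : Prop :=
  (forall k, diagonalizable ((M k)^T *m M k) /\
             \rank (M k) = \rank ((M k)^T *m M k)) /\
  (forall k l, symmetric_mx (M k *m (M l)^T) /\
               symmetric_mx ((M k)^T *m M l)).

(* Main.v *)
Require Import Defs.
From HB Require Import structures.
From mathcomp Require Import all_boot all_order all_algebra.
From mathcomp Require Import ring.
Import Order.TTheory GRing.Theory Num.Theory.
Local Open Scope ring_scope.
Set Implicit Arguments. Unset Strict Implicit. Unset Printing Implicit Defensive.

(** Put S_k = [[0, X_k], [X_k^T, 0]] for the x-slices X_k. Condition (ii) says
    that the symmetric matrices S_k commute, and (i) makes each of them
    diagonalizable, so they have a common eigenbasis. Eigenvectors for distinct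
    characters are orthogonal, hence every nonzero character has a
    non-isotropic eigenvector (u, v), and u.u = v.v because (u, - v) belongs to
    the opposite character. Splitting off such singular pairs one at a time
    gives complex orthogonal U, V with all U X_k V^T diagonal, that is
    t(x, y, z) = sum_a (l_a . x) (U y)_a (V z)_a. Condition (ii) for the
    y-slices makes the l_a pairwise orthogonal, and the rank condition forces
    isotropic l_a to vanish; the remaining ones, normalized, extend to an
    orthonormal basis. *)

Section ComplexOrthogonal.
Variable C : numClosedFieldType.

(** * Complex orthogonal matrices and non-isotropic vectors *)

Lemma trmxD m n (A B : 'M[C]_(m, n)) : (A + B)^T = A^T + B^T.
Proof. exact: raddfD. Qed.

Lemma trmxB m n (A B : 'M[C]_(m, n)) : (A - B)^T = A^T - B^T.
Proof. exact: raddfB. Qed.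

Lemma trmxZ m n (a : C) (A : 'M[C]_(m, n)) : (a *: A)^T = a *: A^T.
Proof. exact: linearZ. Qed.

Lemma orthogonal_mxC n (A : 'M[C]_n) : orthogonal_mx A -> A *m A^T = 1%:M.
Proof. by move=> ?; apply: mulmx1C. Qed.

Lemma orthogonal_mx_unit n (A : 'M[C]_n) : orthogonal_mx A -> A \in unitmx.
Proof. by move=> /orthogonal_mxC/mulmx1_unit[]. Qed.

Lemma orthogonal_mxM n (A B : 'M[C]_n) :
  orthogonal_mx A -> orthogonal_mx B -> orthogonal_mx (A *m B).
Proof.
move=> hA hB; rewrite /orthogonal_mx trmx_mul mulmxA -(mulmxA _ A^T) hA.
by rewrite mulmx1.
Qed.

(** Polarization: if both rows are isotropic, their sum has square [2 * G i j], which is nonzero. *)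
Lemma exists_nonisotropic m n (M : 'M[C]_(m, n)) i j :
    (M *m M^T) i j != 0 ->
  exists a b : C, let w := a *: row i M + b *: row j M in
    (w *m w^T) 0 0 != 0.
Proof.
set G := M *m M^T => Gij.
have GE k l : row k M *m (row l M)^T = (G k l)%:M.
  apply/matrixP=> x y; rewrite !ord1 !mxE eqxx mulr1n.
  by apply: eq_bigr => z _; rewrite !mxE.
have Gji : G j i = G i j 
  by have: G^T = G; [rewrite trmx_mul trmxK | move/matrixP/(_ i j); rewrite mxE].
have wE a b : let w := a *: row i M + b *: row j M in
    (w *m w^T) 0 0 = a ^+ 2 * G i i + 2 * a * b * G i j + b ^+ 2 * G j j.
  rewrite /= trmxD !trmxZ mulmxDl !mulmxDr -!scalemxAl -!scalemxAr.
  by rewrite !GE Gji !mxE eqxx !mulr1n; ring.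
have [Gii|Gii] := eqVneq (G i i) 0; last first.
  by exists 1, 0; rewrite /= wE !(expr0n, expr1n, mulr0, mul0r, mul1r, addr0).
have [Gjj|Gjj] := eqVneq (G j j) 0; last first.
  by exists 0, 1; rewrite /= wE Gii !(expr0n, expr1n, mulr0, mul0r, mul1r, add0r).
exists 1, 1; rewrite /= wE Gii Gjj !(mulr1, mulr0, addr0, add0r).
by rewrite mulf_neq0 // pnatr_eq0.
Qed.

Lemma exists_normalized n (w : 'rV[C]_n) :
    (w *m w^T) 0 0 != 0 ->
  exists2 c : C, c != 0 & (c *: w) *m (c *: w)^T = 1%:M.
Proof.
move=> wN0; exists (sqrtC ((w *m w^T) 0 0))^-1; first by rewrite invr_eq0 sqrtC_eq0.
rewrite trmxZ -scalemxAl -scalemxAr scalerA -expr2 exprVn sqrtCK.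
apply/matrixP=> i j; rewrite !ord1 [LHS]mxE mulVf //.
by rewrite mxE eqxx mulr1n.
Qed.

Lemma reflection_mx_orthogonal n (w : 'rV[C]_n) :
    (w *m w^T) 0 0 != 0 ->
  orthogonal_mx (1%:M - (2 / (w *m w^T) 0 0) *: (w^T *m w)).
Proof.
set q := (w *m w^T) 0 0 => qN0.
have wwT : w *m w^T = q%:M by apply: mx11_scalar.
rewrite /orthogonal_mx trmxB trmxZ tr_scalar_mx trmx_mul trmxK.
rewrite mulmxBl mulmxBr !mul1mx mulmxBr mulmx1 -scalemxAl -scalemxAr.
rewrite mulmxA -(mulmxA w^T) wwT mul_mx_scalar -scalemxAl !scalerA.
have -> : 2 / q * (2 / q * q) = 2 / q + 2 / q by field.
by rewrite scalerDl opprB addrK subrK.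
Qed.

(* [u - e_0] and [u + e_0] cannot both be isotropic; the reflection in a
   non-isotropic one exchanges [u] and [e_0] up to sign. *)
Lemma orthogonal_mx_first_row n (u : 'rV[C]_(1 + n)) :
  u *m u^T = 1%:M ->
  exists2 P : 'M[C]_(1 + n), orthogonal_mx P & delta_mx 0 0 *m P = u.
Proof.
move=> uu; pose e : 'rV[C]_(1 + n) := delta_mx 0 0.
have ee : e *m e^T = 1%:M.
  rewrite trmx_delta mul_delta_mx; apply/matrixP=> i j.
  by rewrite !ord1 !mxE !eqxx.
have eu : e *m u^T = (u 0 0)%:M.
  by rewrite -rowE; apply/matrixP=> i j; rewrite !ord1 !mxE eqxx mulr1n.
have ue : u *m e^T = (u 0 0)%:M.
  by rewrite -[LHS]trmxK trmx_mul trmxK eu tr_scalar_mx.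
have wE (c : C) : c ^+ 2 = 1 ->
    (u - c *: e) *m (u - c *: e)^T = (2 * (1 - c * u 0 0))%:M.
  move=> c2; rewrite trmxB trmxZ mulmxBl !mulmxBr -!scalemxAl -!scalemxAr.
  rewrite scalerA -expr2 c2 scale1r uu ue eu ee.
  by apply/matrixP=> i j; rewrite !ord1 !mxE eqxx !mulr1n; ring.
have main (c : C) : c ^+ 2 = 1 -> 1 - c * u 0 0 != 0 ->
    exists2 P : 'M[C]_(1 + n), orthogonal_mx P & e *m P = u.
  move=> c2 cN0; pose w := u - c *: e.
  have wN0 : (w *m w^T) 0 0 != 0.
    by rewrite wE // mxE eqxx mulr1n mulf_neq0 // pnatr_eq0.
  exists (c *: (1%:M - (2 / (w *m w^T) 0 0) *: (w^T *m w))).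
    rewrite /orthogonal_mx trmxZ -scalemxAl -scalemxAr scalerA -expr2 c2.
    by rewrite scale1r; apply: reflection_mx_orthogonal.
  rewrite -scalemxAr mulmxBr mulmx1 -scalemxAr mulmxA.
  have -> : e *m w^T = (u 0 0 - c)%:M.
    rewrite trmxB trmxZ mulmxBr -scalemxAr eu ee.
    by rewrite scalemx1 -raddfB.
  rewrite wE // mxE eqxx mulr1n mul_scalar_mx scalerA.
  have -> : 2 / (2 * (1 - c * u 0 0)) * (u 0 0 - c) = - c.
    have -> : u 0 0 - c = - c * (1 - c * u 0 0) by rewrite mulrBr mulr1 mulrA mulNr -expr2 c2; ring.
    by field.
  by rewrite scaleNr opprK scalerDr scalerA -expr2 c2 scale1r addrC subrK.
(* The sign [c = 1] works unless [u 0 0 = 1]; then [u + e] has square 4, and [c = -1] works. *)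
have [u1|] := eqVneq (1 - 1 * u 0 0) 0; last exact/main/expr1n.
apply: (main (-1)); rewrite ?sqrrN ?expr1n //.
move: u1; rewrite mul1r => /subr0_eq <-.
by rewrite mulN1r opprK -mulr2n pnatr_eq0.
Qed.

(** * Completing orthonormal families and factoring matrices with orthogonal rows *)

(** Its diagonal matrix projects onto the coordinates in [b], so a partial orthonormal family is
    encoded as a square matrix whose rows outside [b] vanish. *)
Definition indicator_row n (b : {set 'I_n}) : 'rV[C]_n :=
  \row_x (x \in b)%:R.

(* Gap filling, one row at a time: [1 - B^T B] is a nonzero symmetric idempotent
   whose rows are orthogonal to those of [B], so by polarization they span a
   non-isotropic vector. *)
Lemma orthonormal_rows_completion n (b : {set 'I_n}) (B : 'M[C]_n) :
    B *m B^T = diag_mx (indicator_row b) -> diag_mx (indicator_row b) *m B = B ->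
  exists2 A : 'M[C]_n, orthogonal_mx A & diag_mx (indicator_row b) *m A = B.
Proof.
move: {1}(#|~: b|) (erefl #|~: b|) => k; elim: k b B => [|k IH] b B.
  move/esym/eqP; rewrite cards_eq0 => /eqP; rewrite -[set0]setCT => /setC_inj -> BB eB.
  exists B => //; apply: mulmx1C; rewrite BB -diag_const_mx; congr diag_mx.
  by apply/rowP=> i; rewrite !mxE inE.
move=> cb BB eB.
have [a] : exists a, a \in ~: b by apply/set0Pn; rewrite -cards_eq0 -cb.
rewrite inE => ab.
pose e := indicator_row b; pose Q := 1%:M - B^T *m B.
have QT : Q^T = Q by rewrite trmxB tr_scalar_mx trmx_mul trmxK.
have BQ : B *m Q = 0 by rewrite mulmxBr mulmx1 mulmxA BB eB subrr.
have QQ : Q *m Q^T = Q.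
  by rewrite QT {1}/Q mulmxBl mul1mx -mulmxA BQ mulmx0 subr0.
have QN0 : Q != 0.
  apply: contra ab => /eqP/subr0_eq/esym/mulmx1C.
  rewrite BB => /matrixP/(_ a a); rewrite !mxE eqxx !mulr1n.
  by case: (a \in b) => // /esym/eqP; rewrite oner_eq0.
have /matrix0Pn[i [j]] := QN0.
rewrite -QQ => /exists_nonisotropic[x [y]]; set w0 := (_ + _) => wN0.
have Bw0 : B *m w0^T = 0.
  rewrite /w0 trmxD !trmxZ !tr_row QT.
  by rewrite mulmxDr -!scalemxAr !colE !mulmxA BQ !mul0mx !scaler0 addr0.
have [c _] := exists_normalized wN0; set w := c *: w0 => ww.
have Bw : B *m w^T = 0 by rewrite /w trmxZ -scalemxAr Bw0 scaler0.
have wB : w *m B^T = 0 by rewrite -[LHS]trmxK trmx_mul trmxK Bw trmx0.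
pose d : 'cV[C]_n := delta_mx a 0.
have ed : diag_mx e *m d = 0.
  rewrite mul_diag_mx; apply/matrixP=> r s; rewrite !mxE.
  by have [->|_] := eqVneq r a; rewrite ?mulr0 // (negPf ab) mul0r.
have e'E : diag_mx (indicator_row (a |: b)) = diag_mx e + delta_mx a a.
  apply/matrixP=> r s; rewrite !mxE !inE.
  have [->|ra] := eqVneq r a; last by rewrite addr0.
  by rewrite (negPf ab) /= mul0rn add0r eq_sym.
have de : d *m d^T = delta_mx a a by rewrite trmx_delta mul_delta_mx.
(* Row [a] of [B] is zero, so adding [d *m w] writes [w] into it. *)
have [||| A oA eA] := IH (a |: b) (B + d *m w).
- apply/eq_add_S; rewrite cb (cardsD1 a) inE ab add1n.
  by congr _.+1; apply: eq_card => r; rewrite !inE negb_or.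
- rewrite trmxD trmx_mul mulmxDl !mulmxDr BB !mulmxA Bw mul0mx addr0.
  by rewrite -(mulmxA d w B^T) wB mulmx0 add0r -(mulmxA d w) ww mulmx1 e'E de.
- rewrite mulmxDr e'E !mulmxDl eB !mulmxA ed mul0mx add0r.
  have ea : delta_mx a a *m d = d by rewrite mul_delta_mx.
  have eBa : delta_mx a a *m B = 0.
    have de0 : d^T *m diag_mx e = 0.
      by rewrite -[LHS]trmxK trmx_mul trmxK tr_diag_mx ed trmx0.
    by rewrite -eB mulmxA -de -(mulmxA d) de0 mulmx0 mul0mx.
  by rewrite ea eBa addr0.
exists A => //.
have -> : diag_mx (indicator_row b) =
    diag_mx e *m diag_mx (indicator_row (a |: b)).
  rewrite mulmx_diag; congr diag_mx; apply/rowP=> r; rewrite !mxE !inE.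
  by case: (r \in b); rewrite ?orbT ?mulr1 ?mul0r.
by rewrite -mulmxA eA mulmxDr eB mulmxA ed mul0mx addr0.
Qed.

(** Rows with nonzero square are normalized by a square root; the others vanish by hypothesis, and
    their places are filled by completion. *)
Lemma orthogonal_rows_factor n (L : 'M[C]_n) :
    is_diag_mx (L *m L^T) -> (forall a, (L *m L^T) a a = 0 -> row a L = 0) ->
  exists (alpha : 'rV[C]_n) (A : 'M[C]_n),
    orthogonal_mx A /\ L = diag_mx alpha *m A.
Proof.
move=> /diag_mxP[g gE] L0.
have {}L0 a i : g 0 a = 0 -> L a i = 0.
  move=> ga; have : row a L = 0 by apply: L0; rewrite gE mxE eqxx mulr1n.
  by move/rowP/(_ i); rewrite !mxE.
(* Since [0^-1 = 0], [s'] vanishes exactly where [g] does. *)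
pose s := \row_a sqrtC (g 0 a); pose s' := \row_a (sqrtC (g 0 a))^-1.
pose b := [set a | g 0 a != 0].
have [|| A oA eA] := @orthonormal_rows_completion n b (diag_mx s' *m L).
- rewrite trmx_mul mulmxA -(mulmxA _ L) gE tr_diag_mx !mulmx_diag.
  congr diag_mx; apply/rowP=> a; rewrite !mxE inE.
  have [->|ga] := eqVneq; first by rewrite mulr0 mul0r.
  by rewrite mulrAC -expr2 exprVn sqrtCK mulVf.
- rewrite mulmxA mulmx_diag; congr (diag_mx _ *m _); apply/rowP=> a; rewrite !mxE inE.
  by have [->|ga] := eqVneq; rewrite ?mul1r // sqrtC0 invr0 mulr0.
exists s, A; split=> //; transitivity (diag_mx s *m (diag_mx s' *m L)).
  rewrite mulmxA mulmx_diag mul_diag_mx; apply/matrixP=> a i; rewrite !mxE.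
  have [ga|ga] := eqVneq (g 0 a) 0; first by rewrite (L0 _ _ ga) mulr0.
  by rewrite mulfV ?mul1r // sqrtC_eq0.
rewrite -eA mulmxA mulmx_diag; congr (diag_mx _ *m _); apply/rowP=> a; rewrite !mxE inE.
by have [->|ga] := eqVneq; rewrite ?mulr1 // sqrtC0 mulr0.
Qed.

(** * Simultaneous singular value decomposition *)

(* [X k0 != 0] provides an eigenrow [p_i] with nonzero eigenvalue; a row [p_j]
   not orthogonal to it shares all its eigenvalues, so polarization applies
   inside one common eigenspace. *)
Lemma exists_common_singular_pair (I : finType) n m (X : I -> 'M[C]_n)
    (P1 P2 : 'M[C]_(m, n)) (d : I -> 'rV[C]_m) (k0 : I) :
    row_full (row_mx P1 P2) ->
    (forall k, P1 *m X k = diag_mx (d k) *m P2) ->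
    (forall k, P2 *m (X k)^T = diag_mx (d k) *m P1) ->
    X k0 != 0 ->
  exists (u v : 'rV[C]_n) (chi : I -> C),
    [/\ u *m u^T = 1%:M, v *m v^T = 1%:M,
        forall k, u *m X k = chi k *: v & forall k, v *m (X k)^T = chi k *: u].
Proof.
move=> fullP h1 h2 X0.
pose P := row_mx P1 P2; pose S k := block_mx 0 (X k) (X k)^T 0.
have PS k : P *m S k = diag_mx (d k) *m P.
  by rewrite mul_row_block !mulmx0 add0r addr0 h1 h2 mul_mx_row.
have ST k : (S k)^T = S k by rewrite tr_block_mx !trmx0 trmxK.
(* [P] has a left inverse, so [P *m S k0 *m P^T = 0] would force [S k0 = 0]. *)
have /matrix0Pn[i [j]] : diag_mx (d k0) *m (P *m P^T) != 0.
  rewrite mulmxA -PS; apply: contra X0 => /eqP PSP.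
  have /row_fullP[B BP] := fullP.
  have : S k0 = 0.
    rewrite -[S k0]mul1mx -BP -mulmxA -[_ *m S k0]mulmx1 -[1%:M]trmx1 -BP.
    by rewrite trmx_mul !mulmxA -(mulmxA B) -(mulmxA B) PSP mulmx0 mul0mx.
  by rewrite -(block_mx0 C n n n n) => /eq_block_mx[_ -> _ _].
rewrite mul_diag_mx mxE mulf_eq0 negb_or => /andP[di Gij].
(* As [S k] is symmetric, [diag_mx (d k)] commutes with the Gram matrix [P *m P^T], whose entry at
   [i], [j] is nonzero. *)
have dij k : d k 0 i = d k 0 j.
  have : diag_mx (d k) *m (P *m P^T) = (P *m P^T) *m diag_mx (d k).
    rewrite mulmxA -PS -[diag_mx _ in RHS]tr_diag_mx -[RHS]mulmxA -trmx_mul -PS.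
    by rewrite trmx_mul ST mulmxA.
  rewrite mul_diag_mx mul_mx_diag => /matrixP/(_ i j); rewrite mxE [RHS]mxE mulrC.
  exact: mulfI.
have [a [b]] := exists_nonisotropic Gij; set w := (_ + _) => /= wN0.
have wS k : w *m S k = d k 0 i *: w.
  rewrite mulmxDl -!scalemxAl -!row_mul PS !row_mul !row_diag_mx -!scalemxAl -!rowE.
  by rewrite -dij !scalerA ![_ * d k 0 i]mulrC -!scalerA -scalerDr.
have wE : w = row_mx (lsubmx w) (rsubmx w) by rewrite hsubmxK.
move: (lsubmx w) (rsubmx w) wE => w1 w2 wE.
have w1X k : w1 *m X k = d k 0 i *: w2 /\ w2 *m (X k)^T = d k 0 i *: w1.
  have := wS k; rewrite wE mul_row_block !mulmx0 add0r addr0 scale_row_mx.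
  by case/eq_row_mx => -> ->.
(* Multiplied by the nonzero eigenvalue, both sides equal [w2 *m (X k0)^T *m w1^T]. *)
have w12 : w1 *m w1^T = w2 *m w2^T.
  have [e1 e2] := w1X k0; apply: (scalerI di).
  by rewrite scalemxAl -e2 -mulmxA -trmx_mul e1 trmxZ -scalemxAr.
have w1N0 : (w1 *m w1^T) 0 0 != 0.
  move: wN0; rewrite wE tr_row_mx mul_row_col -w12 mxE.
  by apply: contraNneq => ->; rewrite addr0.
have [c _ cw1] := exists_normalized w1N0.
exists (c *: w1), (c *: w2), (fun k => d k 0 i); split=> // [|k|k].
- by rewrite -cw1 !trmxZ -!scalemxAl -!scalemxAr w12.
- by rewrite -scalemxAl (w1X k).1 !scalerA mulrC.
- by rewrite -scalemxAl (w1X k).2 !scalerA mulrC.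
Qed.

Lemma row_full_mul m n p (A : 'M[C]_(m, n)) (B : 'M[C]_(n, p)) :
  row_full A -> row_full B -> row_full (A *m B).
Proof.
move=> /row_fullP[A' A'A] /row_fullP[B' B'B]; apply/row_fullP.
by exists (B' *m A'); rewrite -mulmxA (mulmxA A') A'A mul1mx.
Qed.

Lemma row_full_orthogonal_block n (A B : 'M[C]_n) :
  orthogonal_mx A -> orthogonal_mx B -> row_full (block_mx A^T 0 0 B^T).
Proof.
move=> oA oB; apply/row_fullP; exists (block_mx A 0 0 B).
rewrite mulmx_block !(mulmx0, mul0mx, addr0, add0r) !orthogonal_mxC //.
by rewrite -scalar_mx_block.
Qed.

(* The hypotheses say that the rows of [row_mx P1 P2] are common eigenrows of
   the matrices [block_mx 0 (X k) (X k)^T 0]. In this form they pass to the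
   family obtained by splitting off a singular pair, by projection. *)
Lemma joint_singular_value_decomposition (I : finType) n :
  forall (X : I -> 'M[C]_n) m (P1 P2 : 'M[C]_(m, n)) (d : I -> 'rV[C]_m),
    row_full (row_mx P1 P2) ->
    (forall k, P1 *m X k = diag_mx (d k) *m P2) ->
    (forall k, P2 *m (X k)^T = diag_mx (d k) *m P1) ->
  exists U V : 'M[C]_n, [/\ orthogonal_mx U, orthogonal_mx V &
    forall k, is_diag_mx (U *m X k *m V^T)].
Proof.
have o1 k : orthogonal_mx (1%:M : 'M[C]_k) by rewrite /orthogonal_mx trmx1 mulmx1.
elim: n => [|n IH] X m P1 P2 d fullP h1 h2.
  exists 1%:M, 1%:M; split=> // k; by apply/is_diag_mxP=> -[].
have [/existsP[k0 Xk0]|] := boolP [exists k, X k != 0]; last first.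
  rewrite negb_exists => /forallP X0; exists 1%:M, 1%:M; split=> // k.
  have := X0 k; rewrite negbK => /eqP ->.
  by rewrite mulmx0 mul0mx mx0_is_diag.
have [u [v [chi [uu vv uX vX]]]] := exists_common_singular_pair fullP h1 h2 Xk0.
have [P oP eP] := orthogonal_mx_first_row uu.
have [Q oQ eQ] := orthogonal_mx_first_row vv.
have oPC := orthogonal_mxC oP; have oQC := orthogonal_mxC oQ.
pose Y k : 'M[C]_(1 + n) := P *m X k *m Q^T.
(* In orthonormal bases starting with [u] and [v], the pair equations clear the first row and column
   outside the corner. *)
have YE k : Y k = block_mx (chi k)%:M 0 0 (drsubmx (Y k)).
  have Yr : row 0 (Y k) = chi k *: delta_mx 0 0.
    by rewrite rowE !mulmxA eP uX -scalemxAl -eQ -mulmxA oQC mulmx1.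
  have Yc : col 0 (Y k) = chi k *: delta_mx 0 0.
    have /(congr1 trmx) := vX k.
    rewrite trmx_mul trmxK trmxZ -eQ -eP !trmx_mul !trmx_delta => e.
    by rewrite colE /Y -!mulmxA e -scalemxAr mulmxA oPC mul1mx.
  move: (Y k) Yr Yc => A /rowP Ar /colP Ac.
  have l0 : lshift n 0 = 0 :> 'I_(1 + n) by apply: val_inj.
  rewrite -[LHS]submxK; congr block_mx; apply/matrixP=> i j.
  - by have := Ar 0; rewrite !ord1 !mxE l0 !eqxx mulr1.
  - by have := Ar (rshift 1 j); rewrite ord1 !mxE l0 mulr0.
  - by have := Ac (rshift 1 i); rewrite ord1 !mxE l0 mulr0.
pose P1' := rsubmx (P1 *m P^T : 'M_(m, 1 + n)).
pose P2' := rsubmx (P2 *m Q^T : 'M_(m, 1 + n)).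
have rsub (W : 'M[C]_(m, 1 + n)) : W *m col_mx 0 1%:M = rsubmx W.
  by rewrite -{1}[W]hsubmxK mul_row_col mulmx0 add0r mulmx1.
(* Dropping the first coordinates preserves spanning and, [Y k] being block diagonal, the eigenrow
   equations. The number [m] of rows stays while the dimension drops, so the family may be
   redundant. *)
have [|||U' [V' [oU' oV' UV']]] := IH (fun k => drsubmx (Y k)) m P1' P2' d.
- have -> : row_mx P1' P2' = row_mx P1 P2 *m block_mx P^T 0 0 Q^T
      *m block_mx (col_mx 0 1%:M : 'M_(1 + n, n)) 0
                  0 (col_mx 0 1%:M : 'M_(1 + n, n)).
    rewrite !mul_row_block !(mulmx0, mul0mx) !addr0 !add0r /P1' /P2'.
    by congr row_mx; exact/esym/rsub.
  apply: row_full_mul; first exact/row_full_mul/row_full_orthogonal_block.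
  apply/row_fullP; exists (block_mx (row_mx 0 1%:M) 0 0 (row_mx 0 1%:M)).
  rewrite mulmx_block !(mulmx0, mul0mx) !addr0 !add0r mul_row_col mul0mx.
  by rewrite mulmx1 add0r -scalar_mx_block.
- move=> k.
  have : (P1 *m P^T : 'M_(m, 1 + n)) *m Y k = diag_mx (d k) *m (P2 *m Q^T).
    by rewrite /Y !mulmxA -(mulmxA P1) oP mulmx1 h1.
  rewrite YE -[P1 *m P^T]hsubmxK -[P2 *m Q^T]hsubmxK mul_row_block mul_mx_row.
  by rewrite !mulmx0 addr0 add0r block_mxKdr => /eq_row_mx[].
- move=> k.
  have : (P2 *m Q^T : 'M_(m, 1 + n)) *m (Y k)^T = diag_mx (d k) *m (P1 *m P^T).
    by rewrite /Y !trmx_mul trmxK !mulmxA -(mulmxA P2) oQ mulmx1 h2.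
  rewrite YE -[P1 *m P^T]hsubmxK -[P2 *m Q^T]hsubmxK tr_block_mx !trmx0.
  rewrite mul_row_block mul_mx_row.
  by rewrite !mulmx0 addr0 add0r block_mxKdr => /eq_row_mx[].
have oB (W : 'M[C]_n) : orthogonal_mx W ->
    orthogonal_mx (block_mx 1%:M 0 0 W : 'M[C]_(1 + n)).
  move=> oW; rewrite /orthogonal_mx tr_block_mx trmx1 !trmx0 mulmx_block.
  by rewrite !(mulmx0, mul0mx) !addr0 !add0r mulmx1 oW -scalar_mx_block.
exists (block_mx 1%:M 0 0 U' *m P), (block_mx 1%:M 0 0 V' *m Q).
split=> [||k]; try by apply: orthogonal_mxM => //; exact: oB.
have -> : block_mx 1%:M 0 0 U' *m P *m X k *m (block_mx 1%:M 0 0 V' *m Q)^T =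
    block_mx 1%:M 0 0 U' *m Y k *m (block_mx 1%:M 0 0 V')^T.
  by rewrite trmx_mul !mulmxA.
rewrite YE tr_block_mx !trmx0 !mulmx_block !(mulmx0, mul0mx, addr0, add0r).
have diagB (a : 'M[C]_1) (A : 'M[C]_n) :
    is_diag_mx A -> is_diag_mx (block_mx a 0 0 A).
  by move=> dA; rewrite is_diag_block_mx // !eqxx mx11_is_diag dA.
exact/diagB/UV'.
Qed.

(** * Common eigenrows from the slice conditions *)

(** A spanning family of eigenrows contains a basis, which [fullrankfun] selects. *)
Lemma diagonalizable_eigenrows n m (A : 'M[C]_n) (Q : 'M[C]_(m, n)) (d : 'rV[C]_m) :
  row_full Q -> Q *m A = diag_mx d *m Q -> diagonalizable A.
Proof.
move=> fQ QA; pose f := fullrankfun fQ; pose P := rowsub f Q.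
have uP : P \in unitmx by exact: fullrowsub_unit.
exists P => //; apply/similar_diagPex; exists (colsub f d); apply/similarP => //.
rewrite /P mul_rowsub_mx QA !mul_diag_mx; apply/matrixP=> i j.
by rewrite !mxE.
Qed.

(** Equal ranks give [X] and [X^T *m X] the same row space, so [X^T] is [X^T *m X] times some
    matrix. *)
Lemma gram_cancel n m (X : 'M[C]_n) (A : 'M[C]_(m, n)) :
  \rank X = \rank (X^T *m X) -> A *m (X^T *m X) = 0 -> A *m X^T = 0.
Proof.
move=> rX AN0.
have /submxP[K XE] : (X <= X^T *m X)%MS.
  by rewrite -(mxrank_leqif_sup (submxMl X^T X)) -rX.
have /(congr1 trmx) := XE; rewrite !trmx_mul trmxK => ->.
by rewrite mulmxA AN0 mul0mx.
Qed.

(* If [x] is an eigenrow of [X^T X] for [s ^ 2 != 0] then [(x X^T / s, x)] and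
   [(- x X^T / s, x)] are eigenrows of the block matrix for [s] and [- s];
   the remaining eigenrows are [(0, x)] with [x X^T = 0] and [(y, 0)] with
   [y X = 0], both for the eigenvalue 0. *)
Lemma diagonalizable_antidiag_block n (X : 'M[C]_n) :
    diagonalizable (X^T *m X) -> \rank X = \rank (X^T *m X) ->
  diagonalizable (block_mx 0 X X^T 0).
Proof.
move=> [P uP /similar_diagPex[D /(similarP uP) PN]] rX.
pose s := \row_i sqrtC (D 0 i); pose s' := \row_i (sqrtC (D 0 i))^-1.
pose W := diag_mx s' *m P *m X^T.
have WX : W *m X = diag_mx s *m P.
  rewrite /W -!mulmxA PN mulmxA mulmx_diag; congr (diag_mx _ *m _).
  apply/rowP=> i; rewrite !mxE -{2}[D 0 i]sqrtCK.
  by have [->|] := eqVneq (sqrtC (D 0 i)) 0; [rewrite invr0 mul0r | move=> ?; field].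
(* Where [D 0 i = 0], row [p] of [P] has [p *m (X^T *m X) = 0], and the rank condition yields
   [p *m X^T = 0]. *)
have sW : diag_mx s *m W = P *m X^T.
  apply/eqP; rewrite -subr_eq0 /W !mulmxA mulmx_diag -mulmxBl; apply/eqP.
  apply: gram_cancel => //; rewrite mulmxBl -!mulmxA PN mulmxA mulmx_diag.
  apply/eqP; rewrite subr_eq0; apply/eqP; congr (diag_mx _ *m _).
  apply/rowP=> i; rewrite !mxE -{3 4}[D 0 i]sqrtCK.
  by have [->|] := eqVneq (sqrtC (D 0 i)) 0; [rewrite !mul0r expr0n | move=> ?; field].
pose K := kermx X.
pose Q := col_mx (col_mx (row_mx W P) (row_mx (- W) P)) (row_mx K 0).
pose d := row_mx (row_mx s (- s)) (0 : 'rV_n).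
apply: (@diagonalizable_eigenrows _ _ _ Q d); last first.
  rewrite /Q /d !diag_mx_row raddfN raddf0 /= !mul_block_col !mul_col_mx.
  rewrite !(mul0mx, addr0, add0r) !mul_row_block !(mulmx0, addr0, add0r, mul0mx).
  by rewrite !mul_mx_row !mulNmx mulmxN opprK WX sW mulmx_ker row_mx0.
rewrite -sub1mx.
have := submx_refl Q; rewrite {1}/Q !col_mx_sub => /andP[/andP[R1 R2] R3].
have Q1 : (row_mx 0 P <= Q)%MS.
  have -> : row_mx 0 P = 2^-1 *: (row_mx W P + row_mx (- W) P).
    rewrite add_row_mx subrr -mulr2n -scaler_nat scale_row_mx scaler0 scalerA.
    by rewrite mulVf ?scale1r // pnatr_eq0.
  by rewrite scalemx_sub // addmx_sub.
have Q2 : (row_mx W 0 <= Q)%MS.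
  have -> : row_mx W 0 = row_mx W P - row_mx 0 P.
    by rewrite opp_row_mx add_row_mx oppr0 addr0 subrr.
  by rewrite addmx_sub // eqmx_opp.
(* Modulo the left kernel [K] of [X], the identity is [L *m X^T], whose rows lie in the span of
   those of [W]; hence [Q] also spans the first summand. *)
have /submxP[L XE] : (X <= X^T *m X)%MS.
  by rewrite -(mxrank_leqif_sup (submxMl X^T X)) -rX.
have /submxP[M ME] : (1%:M - L *m X^T <= K)%MS.
  by rewrite sub_kermx mulmxBl mul1mx -mulmxA -XE subrr.
have XTE : X^T = invmx P *m diag_mx s *m W by rewrite -mulmxA sW mulKmx.
rewrite scalar_mx_block block_mxEv col_mx_sub; apply/andP; split.
  have -> : row_mx 1%:M 0 = (L *m invmx P *m diag_mx s) *m row_mx W 0 + M *m row_mx K 0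
      :> 'M_(n, n + n).
    rewrite !mul_mx_row !mulmx0 add_row_mx addr0 -ME; congr row_mx.
    by rewrite -2!mulmxA (mulmxA (invmx P)) -XTE addrC subrK.
  by rewrite addmx_sub // mulmx_sub.
have -> : row_mx 0 1%:M = invmx P *m row_mx 0 P :> 'M_(n, n + n).
  by rewrite mul_mx_row mulmx0 mulVmx.
by rewrite mulmx_sub.
Qed.

(** The product of [S k] and [S l] is block diagonal with blocks [X k *m (X l)^T] and
    [(X k)^T *m X l]; their symmetry says that [S k] and [S l] commute. *)
Lemma slice_conditions_eigenrows n (X : 'I_n -> 'M[C]_n) :
    slice_conditions X ->
  exists m (P1 P2 : 'M[C]_(m, n)) (d : 'I_n -> 'rV[C]_m),
    [/\ row_full (row_mx P1 P2), forall k, P1 *m X k = diag_mx (d k) *m P2 &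
        forall k, P2 *m (X k)^T = diag_mx (d k) *m P1].
Proof.
move=> [diagX symX]; pose S k := block_mx 0 (X k) (X k)^T 0.
have [|P uP /allP dP] := (codiagonalizableP (codom S)).1.
  split=> [_ _ /codomP[k ->] /codomP[l ->]|_ /codomP[k ->]]; last first.
    by have [dX rX] := diagX k; exact: diagonalizable_antidiag_block.
  have symE (A B : 'M[C]_n) : symmetric_mx (A *m B) -> A *m B = B^T *m A^T.
    by rewrite -trmx_mul.
  rewrite /comm_mx !mulmx_block !(mulmx0, mul0mx, addr0, add0r).
  have [s1 s2] := symX k l.
  by rewrite (symE _ _ s1) (symE _ _ s2) !trmxK.
exists (n + n)%N, (lsubmx P), (rsubmx P), (fun k => \row_i conjmx P (S k) i i).
have main k : P *m S k = diag_mx (\row_i conjmx P (S k) i i) *m P.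
  have /dP/similar_diagPex[D sD] := codom_f S k.
  rewrite ((similarP uP) sD); congr (diag_mx _ *m _); apply/rowP=> i.
  by move: sD => /eqP ->; rewrite !mxE eqxx mulr1n.
split=> [|k|k].
- by rewrite hsubmxK row_full_unit.
- have := main k; rewrite -{1 3}[P]hsubmxK mul_row_block mul_mx_row.
  by rewrite !mulmx0 addr0 add0r => /eq_row_mx[].
- have := main k; rewrite -{1 3}[P]hsubmxK mul_row_block mul_mx_row.
  by rewrite !mulmx0 addr0 add0r => /eq_row_mx[].
Qed.

(** * Orthogonally decomposed tensors satisfy the slice conditions *)

Definition odeco_tensor n (alpha : 'I_n -> C) (A B D : 'M[C]_n) : tensor3 C n :=
  fun i j k => \sum_a alpha a * A a i * B a j * D a k.

Lemma tform_odeco n (alpha : 'I_n -> C) (A B D : 'M[C]_n) (x y z : 'cV[C]_n) :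
  tform (odeco_tensor alpha A B D) x y z =
  gform alpha (A *m x) (B *m y) (D *m z).
Proof.
rewrite /gform /tform /odeco_tensor.
transitivity (\sum_a \sum_i \sum_j \sum_k
    alpha a * (A a i * x i 0) * (B a j * y j 0) * (D a k * z k 0)); last first.
  apply: eq_bigr => a _; rewrite !mxE [X in _ = X * _ * _]mulr_sumr !mulr_suml.
  apply: eq_bigr => i _; rewrite [X in _ = X * _]mulr_sumr mulr_suml.
  by apply: eq_bigr => j _; rewrite mulr_sumr.
rewrite [RHS]exchange_big; apply: eq_bigr => i _.
rewrite [RHS]exchange_big; apply: eq_bigr => j _.
rewrite [RHS]exchange_big; apply: eq_bigr => k _.
by rewrite !mulr_suml; apply: eq_bigr => a _; ring.
Qed.

Lemma tform_delta n (T : tensor3 C n) i j k :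
  tform T (delta_mx i 0) (delta_mx j 0) (delta_mx k 0) = T i j k.
Proof.
rewrite /tform (bigD1 i) //= [X in _ + X]big1 => [|i' /negPf ii']; last first.
  by do 2 (apply: big1 => ? _); rewrite !mxE ii' mulr0 !mul0r.
rewrite addr0 (bigD1 j) //= [X in _ + X]big1 => [|j' /negPf jj']; last first.
  by apply: big1 => ? _; rewrite !mxE jj' mulr0 mul0r.
rewrite addr0 (bigD1 k) //= [X in _ + X]big1 => [|k' /negPf kk']; last first.
  by rewrite !mxE kk' mulr0.
by rewrite addr0 !mxE !eqxx !mulr1.
Qed.

Lemma in_OT_odeco n (T : tensor3 C n) :
  in_OT T <->
  exists (alpha : 'I_n -> C) (A B D : 'M[C]_n),
    [/\ orthogonal_mx A, orthogonal_mx B, orthogonal_mx D &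
      forall i j k, T i j k = odeco_tensor alpha A B D i j k].
Proof.
split=> [[A [B [D [alpha [oA oB oD TE]]]]]|[alpha [A [B [D [oA oB oD TE]]]]]].
  exists alpha, A, B, D; split=> // i j k.
  by rewrite -tform_delta TE -tform_odeco tform_delta.
exists A, B, D, alpha; split=> // x y z; rewrite -tform_odeco.
by do 3 (apply: eq_bigr => ? _); rewrite TE.
Qed.

Lemma slice_conditions_diag n (M : 'I_n -> 'M[C]_n) (B D : 'M[C]_n)
    (c : 'I_n -> 'rV[C]_n) :
    orthogonal_mx B -> orthogonal_mx D ->
    (forall k, M k = B^T *m diag_mx (c k) *m D) ->
  slice_conditions M.
Proof.
move=> oB oD ME.
have MtM k l : (M k)^T *m M l = D^T *m (diag_mx (c k) *m diag_mx (c l)) *m D.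
  rewrite !ME !trmx_mul trmxK tr_diag_mx !mulmxA -(mulmxA _ B).
  by rewrite orthogonal_mxC // mulmx1.
have MMt k l : M k *m (M l)^T = B^T *m (diag_mx (c k) *m diag_mx (c l)) *m B.
  rewrite !ME !trmx_mul trmxK tr_diag_mx !mulmxA -(mulmxA _ D).
  by rewrite orthogonal_mxC // mulmx1.
split=> [k|k l]; last first.
  rewrite MtM MMt /symmetric_mx !trmx_mul !trmxK !tr_diag_mx !mulmxA.
  by rewrite -!(mulmxA _ (diag_mx _) (diag_mx _)) (diag_mxC (c l)).
split.
  apply: (@diagonalizable_eigenrows _ _ _ D (\row_j (c k 0 j * c k 0 j))).
    by rewrite row_full_unit orthogonal_mx_unit.
  by rewrite MtM mulmx_diag !mulmxA orthogonal_mxC // mul1mx.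
apply/eqP; rewrite eqn_leq mxrankM_maxr andbT.
have MK : M k = (B^T *m diag_mx (\row_j (c k 0 j)^-1) *m D) *m ((M k)^T *m M k).
  rewrite MtM !mulmxA -(mulmxA _ D) orthogonal_mxC // mulmx1 ME.
  rewrite -!(mulmxA _ (diag_mx _) (diag_mx _)) mulmx_diag.
  rewrite -!(mulmxA _ (diag_mx _) (diag_mx _)) mulmx_diag.
  congr (_ *m diag_mx _ *m _); apply/rowP=> j; rewrite !mxE.
  by have [->|?] := eqVneq (c k 0 j) 0; [rewrite !mulr0 | field].
by rewrite {1}MK mxrankM_maxr.
Qed.

Lemma mx_diag_mulE n (B D : 'M[C]_n) (c : 'rV[C]_n) i j :
  (B^T *m diag_mx c *m D) i j = \sum_a c 0 a * B a i * D a j.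
Proof.
by rewrite mul_mx_diag mxE; apply: eq_bigr => a _; rewrite !mxE [B a i * _]mulrC.
Qed.

Lemma odeco_slice_conditions n (T : tensor3 C n) (alpha : 'I_n -> C)
    (A B D : 'M[C]_n) :
    orthogonal_mx A -> orthogonal_mx B -> orthogonal_mx D ->
    (forall i j k, T i j k = odeco_tensor alpha A B D i j k) ->
  [/\ slice_conditions (xslice T), slice_conditions (yslice T) &
      slice_conditions (zslice T)].
Proof.
move=> oA oB oD TE; split.
- apply: (slice_conditions_diag (c := fun k => \row_a (alpha a * A a k)) oB oD) => k.
  apply/matrixP=> i j; rewrite mx_diag_mulE mxE TE.
  by apply: eq_bigr => a _; rewrite mxE; ring.
- apply: (slice_conditions_diag (c := fun k => \row_a (alpha a * B a k)) oA oD) => k.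
  apply/matrixP=> i j; rewrite mx_diag_mulE mxE TE.
  by apply: eq_bigr => a _; rewrite mxE; ring.
- apply: (slice_conditions_diag (c := fun k => \row_a (alpha a * D a k)) oA oB) => k.
  apply/matrixP=> i j; rewrite mx_diag_mulE mxE TE.
  by apply: eq_bigr => a _; rewrite mxE; ring.
Qed.

(** * The slice conditions produce an orthogonal decomposition *)

Lemma slice_conditions_odeco n (T : tensor3 C n) :
    slice_conditions (xslice T) -> slice_conditions (yslice T) ->
  exists (alpha : 'I_n -> C) (A B D : 'M[C]_n),
    [/\ orthogonal_mx A, orthogonal_mx B, orthogonal_mx D &
      forall i j k, T i j k = odeco_tensor alpha A B D i j k].
Proof.
move=> /slice_conditions_eigenrows[m [P1 [P2 [d [fP e1 e2]]]]] [rankY symY].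
have [U [V [oU oV UV]]] := joint_singular_value_decomposition fP e1 e2.
have oUC := orthogonal_mxC oU; have oVC := orthogonal_mxC oV.
(* Row [a] of [L] is the linear form [l_a] in [x]. *)
pose L := \matrix_(a, k) (U *m xslice T k *m V^T) a a.
have TE k j l : T k j l = \sum_a L a k * U a j * V a l.
  have -> : T k j l = (U^T *m diag_mx (\row_a L a k) *m V) j l.
    have -> : diag_mx (\row_a L a k) = U *m xslice T k *m V^T.
      have /diag_mxP[D DE] := UV k; rewrite DE; congr diag_mx; apply/rowP=> a.
      by rewrite 2!mxE DE mxE eqxx.
    by rewrite !mulmxA oU mul1mx -mulmxA oV mulmx1 mxE.
  by rewrite mx_diag_mulE; apply: eq_bigr => a _; rewrite !mxE.
pose u j : 'rV[C]_n := \row_a U a j.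
have YE j : yslice T j = L^T *m diag_mx (u j) *m V.
  apply/matrixP=> k l; rewrite mx_diag_mulE mxE TE.
  by apply: eq_bigr => a _; rewrite [u j 0 a]mxE [U a j * _]mulrC.
pose G := L *m L^T.
have YtY i j : (yslice T i)^T *m yslice T j =
    V^T *m (diag_mx (u i) *m G *m diag_mx (u j)) *m V.
  by rewrite !YE !trmx_mul trmxK tr_diag_mx !mulmxA.
have uG i j a b : U a i * G a b * U b j = U a j * G a b * U b i.
  have [_] := symY i j.
  rewrite /symmetric_mx YtY => /(congr1 (fun W => V *m W *m V^T)).
  rewrite !trmx_mul !trmxK !tr_diag_mx !mulmxA oVC !mul1mx -!(mulmxA _ V) oVC !mulmx1.
  rewrite -!(mulmxA _ L) -/G.
  rewrite !mul_diag_mx !mul_mx_diag => /matrixP/(_ a b).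
  by rewrite !mxE => <-.
have Urow a b : \sum_i U a i * U b i = (a == b)%:R.
  by have /matrixP/(_ a b) := oUC; rewrite !mxE => <-; apply: eq_bigr => i _; rewrite mxE.
(* Multiplying [uG] by [U a i] and summing over [i] leaves [G a b * U b j] on one side and a factor
   [(a == b)] on the other. *)
have Gdiag : is_diag_mx G.
  apply/is_diag_mxP=> a b ab.
  have GU j : G a b * U b j = 0.
    transitivity (\sum_i U a i * (U a i * G a b * U b j)).
      under eq_bigr => i _ do rewrite -!mulrA mulrA.
      by rewrite -mulr_suml Urow eqxx mul1r.
    under eq_bigr => i _ do rewrite uG mulrCA.
    by rewrite -mulr_sumr Urow -val_eqE (negPf ab) mulr0.
  transitivity (\sum_j G a b * U b j * U b j).
    under eq_bigr => j _ do rewrite -mulrA.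
    by rewrite -mulr_sumr Urow eqxx mulr1.
  by apply: big1 => j _; rewrite GU mul0r.
have [a Ga0|alpha [A [oA LE]]] := orthogonal_rows_factor Gdiag.
  (* With [U a j != 0] and [w] the row [a] of [V], vanishing of row [a] of [G] makes [w] annihilate
     the Gram matrix of [yslice T j]; the rank condition then kills [w *m (yslice T j)^T], which is
     [U a j] times row [a] of [L]. *)
  have [j Uaj] : exists j, U a j != 0.
    have [/existsP//|] := boolP [exists j, U a j != 0].
    rewrite negb_exists => /forallP U0.
    have /eqP := Urow a a; rewrite eqxx big1 ?(eq_sym 0) ?oner_eq0 // => i _.
    by have := U0 i; rewrite negbK => /eqP ->; rewrite mul0r.
  have [_ rY] := rankY j.
  pose w : 'rV[C]_n := delta_mx 0 a *m V.
  have wV : w *m V^T = delta_mx 0 a by rewrite -mulmxA oVC mulmx1.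
  have : w *m (yslice T j)^T = 0.
    apply: gram_cancel => //; rewrite YtY !mulmxA wV.
    have -> : delta_mx 0 a *m diag_mx (u j) = u j 0 a *: delta_mx 0 a :> 'rV_n.
      by rewrite -rowE row_diag_mx.
    have eG : delta_mx 0 a *m G = 0 :> 'rV_n.
      have /diag_mxP[g gE] := Gdiag; rewrite -rowE gE row_diag_mx.
      by move: Ga0; rewrite -/G gE mxE eqxx mulr1n => ->; rewrite scale0r.
    by rewrite -(mulmxA _ L) -/G -[_ *: _ *m G]scalemxAl eG scaler0 !mul0mx.
  rewrite YE !trmx_mul trmxK tr_diag_mx !mulmxA wV -rowE row_diag_mx -scalemxAl -rowE.
  by move/eqP; rewrite scaler_eq0 mxE (negPf Uaj) => /eqP.
exists (alpha 0), A, U, V; split=> // i j k; rewrite TE.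
by apply: eq_bigr => a _; rewrite LE mul_diag_mx mxE.
Qed.
End ComplexOrthogonal.

Theorem theorem39 (C : numClosedFieldType) (n : nat) (T : tensor3 C n) :
  in_OT T <->
  [/\ slice_conditions (xslice T),
      slice_conditions (yslice T) &
      slice_conditions (zslice T)].
Proof.
split=> [/in_OT_odeco[alpha [A [B [D [oA oB oD TE]]]]]|[Tx Ty _]].
  exact: odeco_slice_conditions oA oB oD TE.
exact/in_OT_odeco/slice_conditions_odeco.
Qed.
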